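(* There is a constant $c \in \left(15/(1493)^{1/4},\, 2^{3/2}\right]$ (numerically $c\in(2.413\ldots, 2.828\ldots]$) such that for every integer $n \geq 1$ there exist integers $x, y$ with $$n < x^{2} + y^{2} < n + c\, n^{1/4}.$$ Moreover, for any constant $c > 15/(1493)^{1/4}$, for every integer $n$ with $1 \leq n \leq 10^{8}$ there exist integers $x, y$ with $$n < x^{2} + y^{2} < n + c\, n^{1/4}.$$ *)

(* Defs.v *)
From Stdlib Require Export ZArith Reals.

(* Main.v *)
(** With [x = floor (sqrt n)] and [m = n - x^2 <= 2 x], the constant [2^(3/2)] comes from
    comparing [(x+1)^2] and [x^2 + (floor (sqrt m) + 1)^2]: if the first overshoots [n] by
    [u = 2^(3/2) n^(1/4)] or more, then [m <= 2 x + 1 - u <= (u/2 - 1)^2], so the second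
    overshoots by at most [2 sqrt m + 1 <= u - 1].

    For [n <= 10^8] the claim reduces to the integer inequality
    [1493 (s - n)^4 <= 50625 n] for some sum of two squares [s > n], which is sharp at
    [n = 1493], [s = 1508].  The integers [x^2 <= n < (x+1)^2] are treated together.
    A jump [G] with [1493 G^4 <= 50625 x^2] is admissible at all of them, and the sums
    [x^2 + y^2] leave only few gaps longer than [G], those with [2 y + 1 > G].  Each such gap
    is split by a sum [(x - j)^2 + z^2] with a small [j], found by computation. *)

Require Import Defs.
From Stdlib Require Import ZArith Reals Lia Lra.
Open Scope R_scope.

(** * Roots *)

Lemma pow4_lt_reg (a b : R) : 0 <= b -> a ^ 4 < b ^ 4 -> a < b.
Proof.
  intros Hb H. destruct (Rlt_le_dec a b) as [|Hle]; [assumption|].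
  pose proof (pow_incr b a 4 (conj Hb Hle)). lra.
Qed.

Lemma pow4_le_reg (a b : R) : 0 <= b -> a ^ 4 <= b ^ 4 -> a <= b.
Proof.
  intros Hb H. destruct (Rle_lt_dec a b) as [|Hlt]; [assumption|].
  destruct (Rle_lt_or_eq_dec _ _ H) as [H'|H'].
  - apply Rlt_le, pow4_lt_reg; assumption.
  - pose proof (pow_incr b a 4 (conj Hb (Rlt_le _ _ Hlt))).
    (* These are the terms of [a^4 - b^4 = (a - b) * (a^3 + a^2 * b + a * b^2 + b^3)]. *)
    assert (0 < (a - b) * (a * a * a)) by (repeat apply Rmult_lt_0_compat; lra).
    assert (0 <= (a - b) * (a * a * b)) by (repeat apply Rmult_le_pos; lra).
    assert (0 <= (a - b) * (a * b * b)) by (repeat apply Rmult_le_pos; lra).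
    assert (0 <= (a - b) * (b * b * b)) by (repeat apply Rmult_le_pos; lra).
    nra.
Qed.

Lemma Rpower_quarter_pow4 (a : R) : 0 < a -> Rpower a (1 / 4) ^ 4 = a.
Proof.
  intros Ha. rewrite <- (Rpower_pow 4) by apply exp_pos.
  rewrite Rpower_mult. replace (1 / 4 * INR 4) with 1 by (simpl; field).
  apply Rpower_1, Ha.
Qed.

Lemma Rpower_2_3_2_sqr : Rpower 2 (3 / 2) * Rpower 2 (3 / 2) = 8.
Proof.
  rewrite <- Rpower_plus. replace (3 / 2 + 3 / 2) with (INR 3) by (simpl; field).
  rewrite Rpower_pow by lra. ring.
Qed.

(** Taking fourth powers leaves [15^4 = 50625 < 64 * 1493]. *)
Lemma constants_lt : 15 / Rpower 1493 (1 / 4) < Rpower 2 (3 / 2).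
Proof.
  assert (Hq : 0 < Rpower 1493 (1 / 4)) by apply exp_pos.
  assert (Hc : 0 < Rpower 2 (3 / 2)) by apply exp_pos.
  apply (Rmult_lt_reg_r (Rpower 1493 (1 / 4))); [assumption|].
  unfold Rdiv at 1. rewrite Rmult_assoc, Rinv_l, Rmult_1_r by lra.
  apply pow4_lt_reg; [nra|].
  rewrite Rpow_mult_distr, Rpower_quarter_pow4 by lra.
  replace (Rpower 2 (3 / 2) ^ 4)
    with ((Rpower 2 (3 / 2) * Rpower 2 (3 / 2)) * (Rpower 2 (3 / 2) * Rpower 2 (3 / 2)))
    by ring.
  rewrite Rpower_2_3_2_sqr. lra.
Qed.

Lemma Zsqrt_bounds (n : Z) : (0 <= n)%Z ->
  (Z.sqrt n * Z.sqrt n <= n < (Z.sqrt n + 1) * (Z.sqrt n + 1))%Z.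
Proof. exact (Z.sqrt_spec n). Qed.

(** * The bound for all n *)

Lemma sum_two_squares_gap_all (n : Z) : (1 <= n)%Z ->
  exists x y : Z,
    IZR n < IZR (x ^ 2 + y ^ 2) < IZR n + Rpower 2 (3 / 2) * Rpower (IZR n) (1 / 4).
Proof.
  intros Hn.
  assert (HnR : 1 <= IZR n) by (apply IZR_le; lia).
  pose proof (Zsqrt_bounds n ltac:(lia)) as Hx.
  pose proof (Z.sqrt_nonneg n) as Hx0.
  set (x := Z.sqrt n) in *.
  pose proof (Zsqrt_bounds (n - x * x) ltac:(lia)) as Hy.
  pose proof (Z.sqrt_nonneg (n - x * x)) as Hy0.
  set (y := Z.sqrt (n - x * x)) in *.
  set (r := Rpower (IZR n) (1 / 4)).
  assert (Hr : 0 < r) by apply exp_pos.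
  assert (Hr4 : r ^ 4 = IZR n) by (apply Rpower_quarter_pow4; lra).
  set (u := Rpower 2 (3 / 2) * r).
  assert (Hu : 0 < u) by (apply Rmult_lt_0_compat; [apply exp_pos | assumption]).
  assert (Hu2 : u * u = 8 * (r * r)).
  { rewrite <- Rpower_2_3_2_sqr. unfold u. ring. }
  assert (Hx1 : 1 <= IZR x) by (apply IZR_le; nia).
  assert (Hxr : IZR x <= r * r).
  { assert (IZR x * IZR x <= (r * r) * (r * r)); [|nra].
    replace (r * r * (r * r)) with (r ^ 4) by ring.
    rewrite Hr4, <- mult_IZR. apply IZR_le. lia. }
  destruct (Rlt_le_dec (IZR ((x + 1) ^ 2)) (IZR n + u)) as [Hlt|Hge].
  - exists (x + 1)%Z, 0%Z. replace ((x + 1) ^ 2 + 0 ^ 2)%Z with ((x + 1) ^ 2)%Z by ring.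
    split; [apply IZR_lt; nia | assumption].
  - exists x, (y + 1)%Z. split; [apply IZR_lt; nia |].
    assert (Hyn : IZR x * IZR x + IZR y * IZR y <= IZR n).
    { rewrite <- !mult_IZR, <- plus_IZR. apply IZR_le. lia. }
    assert (HyR : 0 <= IZR y) by (apply IZR_le; assumption).
    rewrite Z.pow_2_r, mult_IZR, plus_IZR in Hge.
    rewrite plus_IZR, !Z.pow_2_r, !mult_IZR, plus_IZR.
    assert (2 * IZR y + 1 < u); [|lra].
    destruct (Rlt_le_dec (2 * IZR y + 1) u) as [|Hyu]; [assumption|].
    assert (2 <= u) by nra.
    assert ((u - 1) * (u - 1) <= 4 * (IZR y * IZR y)) by nra.
    (* [Hge] and [x <= u * u / 8] give [4 * y * y <= (u - 2) * (u - 2)], against the previous bound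
       since [2 <= u]. *)
    nra.
Qed.

(** * The bound up to 10^8 *)

(** Fourth power of [s - n <= 15 / 1493^(1/4) * n^(1/4)], as [50625 = 15^4]. Equality occurs at
    [n = 1493], [s = 1508]; the strict bound on [c] makes up for it. *)
Definition short_gap (n : Z) : Prop :=
  exists x y : Z,
    (n < x ^ 2 + y ^ 2 /\ 1493 * (x ^ 2 + y ^ 2 - n) ^ 4 <= 50625 * n)%Z.

Lemma short_gap_bound (n : Z) (c : R) :
  (1 <= n)%Z -> short_gap n -> 15 / Rpower 1493 (1 / 4) < c ->
  exists x y : Z,
    IZR n < IZR (x ^ 2 + y ^ 2) < IZR n + c * Rpower (IZR n) (1 / 4).
Proof.
  intros Hn [x [y [Hlt Hle]]] Hc. exists x, y. split; [apply IZR_lt, Hlt|].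
  set (s := (x ^ 2 + y ^ 2)%Z) in *.
  assert (HnR : 1 <= IZR n) by (apply IZR_le; lia).
  set (r := Rpower (IZR n) (1 / 4)).
  assert (Hr : 0 < r) by apply exp_pos.
  assert (Hr4 : r ^ 4 = IZR n) by (apply Rpower_quarter_pow4; lra).
  set (q := Rpower 1493 (1 / 4)) in *.
  assert (Hq : 0 < q) by apply exp_pos.
  assert (Hq4 : q ^ 4 = 1493) by (apply Rpower_quarter_pow4; lra).
  assert (Hs : IZR (s - n) * q <= 15 * r).
  { apply pow4_le_reg; [lra|]. rewrite !Rpow_mult_distr, Hq4, Hr4, pow_IZR.
    apply IZR_le in Hle. rewrite !mult_IZR in Hle.
    change (Z.of_nat 4) with 4%Z. lra. }
  assert (IZR (s - n) <= 15 / q * r).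
  { apply (Rmult_le_reg_r q); [assumption|].
    replace (15 / q * r * q) with (15 * r) by (field; lra). assumption. }
  rewrite minus_IZR in *. nra.
Qed.

Open Scope Z_scope.

(** * Gaps between two consecutive squares *)

Lemma short_gap_jump (x G a b n : Z) :
  0 <= G -> 1493 * G ^ 4 <= 50625 * (x * x) -> x * x <= n ->
  n < a ^ 2 + b ^ 2 <= n + G -> short_gap n.
Proof.
  intros HG0 HG Hxn Hab. exists a, b. split; [lia|].
  assert ((a ^ 2 + b ^ 2 - n) ^ 4 <= G ^ 4) by (apply Z.pow_le_mono_l; lia).
  lia.
Qed.

(* Here [t - z^2 = x^2 + hi - ((x - j)^2 + z^2)]; only the largest admissible [z] is tried. *)
Fixpoint window (fuel : nat) (x j lo hi : Z) : bool :=
  match fuel with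
  | O => false
  | S f =>
      let t := hi + j * (2 * x - j) in
      let z := Z.sqrt t in
      if t - z * z <=? hi - lo then true else window f x (j + 1) lo hi
  end.

Lemma window_sound (fuel : nat) (x j lo hi : Z) :
  0 <= hi -> 0 <= j -> j + Z.of_nat fuel <= 2 * x -> window fuel x j lo hi = true ->
  exists a b : Z, x * x + lo <= a ^ 2 + b ^ 2 <= x * x + hi.
Proof.
  revert j. induction fuel as [|f IH]; intros j Hhi Hj Hf; [discriminate|].
  cbn [window].
  assert (Ht : 0 <= hi + j * (2 * x - j)) by nia.
  pose proof (Zsqrt_bounds _ Ht) as Hz.
  set (z := Z.sqrt (hi + j * (2 * x - j))) in *.
  destruct (Z.leb_spec (hi + j * (2 * x - j) - z * z) (hi - lo)).
  - intros _. exists (x - j), z. nia.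
  - apply IH; lia.
Qed.

(** All values are offsets from [x * x]; the cap [2 * x + 1] stands for [(x + 1)^2]. A sum in
    [[nxt - G, cur + G]] is within [G] of both ends of a long gap. *)
Fixpoint gaps (fuel : nat) (x G y : Z) : bool :=
  match fuel with
  | O => false
  | S f =>
      let cur := y * y in
      let nxt := Z.min ((y + 1) * (y + 1)) (2 * x + 1) in
      if (if nxt - cur <=? G then true else window 75 x 1 (nxt - G) (cur + G))
      then if 2 * x + 1 <=? nxt then true else gaps f x G (y + 1)
      else false
  end.

Lemma gaps_sound (fuel : nat) (x G y m : Z) :
  38 <= x -> 0 <= G -> 1493 * G ^ 4 <= 50625 * (x * x) -> 0 <= y ->
  gaps fuel x G y = true -> y * y <= m <= 2 * x -> short_gap (x * x + m).
Proof.
  intros Hx HG0 HG. revert y. induction fuel as [|f IH]; intros y Hy; [discriminate|].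
  cbn [gaps].
  set (nxt := Z.min ((y + 1) * (y + 1)) (2 * x + 1)).
  assert (Hnxt : exists a b, a ^ 2 + b ^ 2 = x * x + nxt).
  { destruct (Z.min_spec ((y + 1) * (y + 1)) (2 * x + 1)) as [[_ E]|[_ E]];
      unfold nxt; rewrite E.
    - exists x, (y + 1). ring.
    - exists (x + 1), 0. ring. }
  destruct Hnxt as [a [b Hab]].
  destruct (if nxt - y * y <=? G then true else _) eqn:Hgap; [|discriminate].
  intros Hrest Hm.
  destruct (Z.lt_ge_cases m nxt) as [Hlt|Hge].
  - destruct (Z.leb_spec (nxt - y * y) G).
    + apply (short_gap_jump x G a b); lia.
    (* The fuel 75 started at [j = 1] requires [76 <= 2 * x], hence [38 <= x]. *)
    + apply window_sound in Hgap; [|nia|lia|lia].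
      destruct Hgap as [a' [b' Hab']].
      (* Before the splitting sum, jump to it; from it on, jump to [nxt]. *)
      destruct (Z.lt_ge_cases (x * x + m) (a' ^ 2 + b' ^ 2)).
      * apply (short_gap_jump x G a' b'); lia.
      * apply (short_gap_jump x G a b); lia.
  - destruct (Z.leb_spec (2 * x + 1) nxt); [lia|].
    apply (IH (y + 1)); [lia|assumption|lia].
Qed.

(* Below [y = G / 2] the gaps are short anyway. *)
Definition row (x : Z) : bool :=
  let G := Z.sqrt (Z.sqrt (50625 * (x * x) / 1493)) in gaps 100 x G (G / 2).

Lemma row_sound (x n : Z) :
  38 <= x -> row x = true -> x * x <= n < (x + 1) * (x + 1) -> short_gap n.
Proof.
  intros Hx. unfold row.
  pose proof (Z.div_pos (50625 * (x * x)) 1493 ltac:(nia) ltac:(lia)) as Hv0.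
  pose proof (Z.mul_div_le (50625 * (x * x)) 1493 ltac:(lia)) as Hv.
  set (v := 50625 * (x * x) / 1493) in *.
  pose proof (Z.sqrt_nonneg v) as Hw0.
  pose proof (Zsqrt_bounds v Hv0) as Hw.
  set (w := Z.sqrt v) in *.
  pose proof (Z.sqrt_nonneg w) as HG0.
  pose proof (Zsqrt_bounds w Hw0) as HGw.
  set (G := Z.sqrt w) in *.
  assert (HG : 1493 * G ^ 4 <= 50625 * (x * x)).
  { replace (G ^ 4) with ((G * G) * (G * G)) by ring.
    assert ((G * G) * (G * G) <= w * w) by (apply Z.mul_le_mono_nonneg; nia).
    lia. }
  pose proof (Z.mul_div_le G 2 ltac:(lia)) as Hy.
  pose proof (Z.div_pos G 2 ltac:(lia) ltac:(lia)) as Hy0.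
  set (y := G / 2) in *.
  intros Hgaps Hn.
  destruct (Z.lt_ge_cases (n - x * x) (y * y)) as [Hlt|Hge].
  - pose proof (Zsqrt_bounds (n - x * x) ltac:(lia)) as Hr.
    pose proof (Z.sqrt_nonneg (n - x * x)) as Hr0.
    set (r := Z.sqrt (n - x * x)) in *.
    assert (r < y) by nia.
    (* The overshoot is at most [2 * r + 1 <= 2 * y - 1 < G]. *)
    apply (short_gap_jump x G x (r + 1)); nia.
  - replace n with (x * x + (n - x * x)) by ring.
    apply (gaps_sound 100 x G y); try assumption; lia.
Qed.

(** * Exhaustive verification *)

Fixpoint all_from (P : Z -> bool) (fuel : nat) (x : Z) : bool :=
  match fuel with
  | O => true
  | S f => if P x then all_from P f (x + 1) else false
  end.

Lemma all_from_sound (P : Z -> bool) (fuel : nat) (x z : Z) :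
  all_from P fuel x = true -> x <= z < x + Z.of_nat fuel -> P z = true.
Proof.
  revert x. induction fuel as [|f IH]; intros x H Hz; [lia|].
  cbn [all_from] in H. destruct (P x) eqn:HP; [|discriminate].
  destruct (Z.eq_dec x z) as [<-|]; [assumption|].
  apply (IH (x + 1)); [assumption|lia].
Qed.

(** The rows run over [39 <= x <= 10000], the last one serving [n = 10^8]. *)
Lemma rows_true : all_from row (Z.to_nat 9962) 39 = true.
Proof. vm_cast_no_check (eq_refl true). Qed.

(* [G] of [row] is computed at [x^2] and is too small for [n = 20] and for the extremal
   [n = 1493], so the range below [39^2] is tested value by value. *)
Fixpoint search (fuel : nat) (n x : Z) : bool :=
  match fuel with
  | O => false
  | S f =>
      let y := Z.sqrt (n - x * x) + 1 in
      let d := x * x + y * y - n in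
      if andb (0 <? d) (1493 * d ^ 4 <=? 50625 * n) then true else search f n (x - 1)
  end.

Lemma search_sound (fuel : nat) (n x : Z) : search fuel n x = true -> short_gap n.
Proof.
  revert x. induction fuel as [|f IH]; intros x; [discriminate|].
  cbn [search]. set (y := Z.sqrt (n - x * x) + 1).
  destruct (Z.ltb_spec 0 (x * x + y * y - n)); [|apply IH].
  destruct (Z.leb_spec (1493 * (x * x + y * y - n) ^ 4) (50625 * n)); [|apply IH].
  intros _. exists x, y. rewrite !Z.pow_2_r. lia.
Qed.

(** The range ends at [1520 = 39^2 - 1]. There [Z.sqrt n <= 38], so fuel 40 lets [x] descend past
    0. *)
Lemma small_true :
  all_from (fun n => search 40 n (Z.sqrt n)) (Z.to_nat 1520) 1 = true.
Proof. vm_cast_no_check (eq_refl true). Qed.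

Lemma short_gap_upto (n : Z) : 1 <= n <= 10 ^ 8 -> short_gap n.
Proof.
  intros Hn. destruct (Z.lt_ge_cases n 1521).
  - apply (search_sound 40 n (Z.sqrt n)).
    apply (all_from_sound _ _ _ n small_true). lia.
  - pose proof (Zsqrt_bounds n ltac:(lia)) as Hx.
    set (x := Z.sqrt n) in *.
    assert (39 <= x <= 10000) by nia.
    apply (row_sound x n); [lia| |lia].
    apply (all_from_sound _ _ _ x rows_true). lia.
Qed.

Open Scope R_scope.

Theorem theorem1 :
  (exists c : R,
     15 / Rpower 1493 (1 / 4) < c <= Rpower 2 (3 / 2) /\
     forall n : Z, (1 <= n)%Z ->
       exists x y : Z,
         IZR n < IZR (x ^ 2 + y ^ 2) < IZR n + c * Rpower (IZR n) (1 / 4)) /\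
  (forall c : R, 15 / Rpower 1493 (1 / 4) < c ->
     forall n : Z, (1 <= n <= 10 ^ 8)%Z ->
       exists x y : Z,
         IZR n < IZR (x ^ 2 + y ^ 2) < IZR n + c * Rpower (IZR n) (1 / 4)).
Proof.
  split.
  - exists (Rpower 2 (3 / 2)). split.
    + split; [apply constants_lt | apply Rle_refl].
    + exact sum_two_squares_gap_all.
  - intros c Hc n Hn. apply short_gap_bound; [lia | | assumption].
    apply short_gap_upto, Hn.
Qed.
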